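(* Define integers $B'(n)$, $n\ge1$, by \[ \sum_{n=1}^\infty B'(n) q^n := \sum_{n=1}^\infty q^{n}(-q^{n+1};q)_\infty^2 (q^{n+1};q)_\infty (q^{n+1};q)_{n}. \] Then \[ \sum_{n=1}^\infty q^{n}(-q^{n+1};q)_\infty^2 (q^{n+1};q)_\infty (q^{n+1};q)_{n} = \Big(\sum_{n=0}^\infty q^{\frac{n(n+1)}{2}} \Big)^2 - \sum_{n=0}^\infty q^{\frac{n(n+1)}{2}}. \]
   Context: Here $q$ is a complex number with $|q|<1$ (equivalently, identities of formal power series in $q$). Notation: $(a;q)_0=1$, $(a;q)_n=\prod_{j=0}^{n-1}(1-aq^j)$, $(a;q)_\infty=\prod_{j=0}^{\infty}(1-aq^j)$, and $(a;q)_\infty^k$ denotes the $k$-th power of $(a;q)_\infty$. *)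

(* Defs.v *)
From Stdlib Require Import Reals ZArith Lra Lia.
From Coquelicot Require Import Coquelicot.

Open Scope C_scope.

(* [iota] picks the limit when it exists and an unspecified value otherwise. *)
Definition CLim_seq (u : nat -> C) : C :=
  iota (T := C_CompleteNormedModule)
    (fun l : C => filterlim u eventually (locally l)).

Definition CSeries (u : nat -> C) : C :=
  iota (T := C_CompleteNormedModule) (fun l : C => is_series u l).

Fixpoint qpoch (a q : C) (n : nat) : C :=
  match n with
  | O => 1
  | S m => qpoch a q m * (1 - a * q ^ m)
  end.

Definition qpoch_inf (a q : C) : C := CLim_seq (qpoch a q).

Definition summand (q : C) (n : nat) : C :=
  q ^ n * qpoch_inf (- q ^ (n + 1)) q ^ 2
        * qpoch_inf (q ^ (n + 1)) q * qpoch (q ^ (n + 1)) q n.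

(* Coquelicot series start at index 0, hence the shift to n >= 1. *)
Definition lhs (q : C) : C := CSeries (fun n => summand q (S n)).

Definition triangular_term (q : C) (n : nat) : C := q ^ (n * (n + 1) / 2).

Definition psi (q : C) : C := CSeries (triangular_term q).

(* [B n] is meaningful for n >= 1 only; [B 0] is unconstrained. *)
Definition generates_lhs (B : nat -> Z) : Prop :=
  forall q : C, (Cmod q < 1)%R ->
    is_series (fun n => RtoC (IZR (B (S n))) * q ^ (S n)) (lhs q).

(* For |q| < 1 the products and the theta series are genuine limits, so the
   default value of [iota] plays no role in them. *)

Lemma CLim_seq_unique (u : nat -> C) (l : C) :
  filterlim u eventually (locally l) -> CLim_seq u = l.
Proof.
intros H.
apply (iota_filterlim_locally (V := C_CompleteNormedModule) u l H).
Qed.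

Lemma CSeries_unique (u : nat -> C) (l : C) : is_series u l -> CSeries u = l.
Proof.
intros H.
apply (iota_filterlim_locally (V := C_CompleteNormedModule) (sum_n u) l H).
Qed.

Lemma CSeries_correct (u : nat -> C) : ex_series u -> is_series u (CSeries u).
Proof. intros [l Hl]. now rewrite (CSeries_unique u l Hl). Qed.

Lemma qpoch_bound (a q : C) (n : nat) : (Cmod q < 1)%R ->
  (Cmod (qpoch a q n) <= exp (Cmod a * / (1 - Cmod q) * (1 - Cmod q ^ n)))%R.
Proof.
intros Hq. induction n as [|n IH].
- simpl. rewrite Cmod_1. replace (_ * _)%R with 0%R by ring. rewrite exp_0; lra.
- change (qpoch a q (S n)) with (qpoch a q n * (1 - a * q ^ n)).
  rewrite Cmod_mult.
  replace (Cmod a * / (1 - Cmod q) * (1 - Cmod q ^ S n))%R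
    with (Cmod a * / (1 - Cmod q) * (1 - Cmod q ^ n) + Cmod a * Cmod q ^ n)%R
    by (simpl; field; lra).
  rewrite exp_plus.
  apply Rmult_le_compat; try apply Cmod_ge_0; [exact IH|].
  apply Rle_trans with (1 + Cmod a * Cmod q ^ n)%R.
  + unfold Cminus. eapply Rle_trans; [apply Cmod_triangle|].
    rewrite Cmod_1, Cmod_opp, Cmod_mult, Cmod_pow. lra.
  + apply exp_ineq1_le.
Qed.

Lemma qpoch_inf_correct (a q : C) : (Cmod q < 1)%R ->
  filterlim (qpoch a q) eventually (locally (qpoch_inf a q)).
Proof.
intros Hq.
pose proof (Cmod_ge_0 a) as Ha. pose proof (Cmod_ge_0 q) as Hq0.
set (M := exp (Cmod a * / (1 - Cmod q))).
assert (HM : forall n, (Cmod (qpoch a q n) <= M)%R).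
{ intros n. eapply Rle_trans; [apply (qpoch_bound a q n Hq)|].
  pose proof (pow_le (Cmod q) n Hq0) as Hp.
  assert (Hc : (0 <= Cmod a * / (1 - Cmod q))%R).
  { apply Rmult_le_pos; [lra|]. left. apply Rinv_0_lt_compat. lra. }
  unfold M. set (c := (Cmod a * / (1 - Cmod q))%R) in *.
  destruct (Rle_lt_or_eq_dec (c * (1 - Cmod q ^ n)) c) as [H|H].
  - pose proof (Rmult_le_pos c (Cmod q ^ n) Hc Hp). lra.
  - left. now apply exp_increasing.
  - rewrite H. lra. }
set (d := fun n => qpoch a q n * (- (a * q ^ n))).
assert (Hd : ex_series (V := C_NormedModule) d).
{ apply (ex_series_le (V := C_CompleteNormedModule) d
           (fun n => scal (M * Cmod a)%R (Cmod q ^ n)%R)).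
  - intros n. change (norm (d n)) with (Cmod (d n)). unfold d.
    rewrite Cmod_mult, Cmod_opp, Cmod_mult, Cmod_pow.
    change (Cmod (qpoch a q n) * (Cmod a * Cmod q ^ n)
              <= M * Cmod a * Cmod q ^ n)%R.
    rewrite Rmult_assoc. apply Rmult_le_compat_r; [|apply HM].
    apply Rmult_le_pos; [lra|]. now apply pow_le.
  - apply (ex_series_scal (V := R_NormedModule)), ex_series_geom.
    rewrite Rabs_pos_eq; lra. }
destruct Hd as [l Hl].
assert (Hs : forall n, sum_n d n = qpoch a q (S n) - 1).
{ induction n as [|n IH].
  - rewrite sum_O. unfold d.
    change (1 * - (a * 1) = 1 * (1 - a * 1) - 1 :> C). ring.
  - rewrite sum_Sn, IH. unfold d.
    set (x := qpoch a q (S n)).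
    change (x - 1 + x * - (a * q ^ S n) = x * (1 - a * q ^ S n) - 1 :> C).
    ring. }
assert (H1 : filterlim (fun n => qpoch a q (S n)) eventually (locally (l + 1))).
{ apply filterlim_ext with (fun n => plus (sum_n d n) (1 : C)).
  - intros n. rewrite Hs. set (x := qpoch a q (S n)).
    change (x - 1 + 1 = x :> C). ring.
  - apply (filterlim_comp_2 (G := locally l) (H := locally (1 : C))).
    + exact Hl.
    + apply filterlim_const.
    + apply (filterlim_plus (V := C_NormedModule)). }
assert (H2 : filterlim (qpoch a q) eventually (locally (l + 1))).
{ intros P HP. destruct (H1 P HP) as [N HN]. exists (S N). intros [|n] Hn.
  - lia.
  - apply HN. lia. }
unfold qpoch_inf. now rewrite (CLim_seq_unique _ _ H2).
Qed.

Lemma psi_correct (q : C) : (Cmod q < 1)%R ->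
  is_series (triangular_term q) (psi q).
Proof.
intros Hq. pose proof (Cmod_ge_0 q) as Hq0.
apply CSeries_correct.
apply (ex_series_le (V := C_CompleteNormedModule) (triangular_term q)
         (fun n => (Cmod q ^ n)%R)).
- intros n.
  change (norm (triangular_term q n)) with (Cmod (triangular_term q n)).
  unfold triangular_term. rewrite Cmod_pow.
  assert (Hn : (n <= n * (n + 1) / 2)%nat).
  { apply Nat.div_le_lower_bound; [lia|]. destruct n; nia. }
  replace (n * (n + 1) / 2)%nat
    with (n + (n * (n + 1) / 2 - n))%nat by lia.
  rewrite pow_add.
  rewrite <- (Rmult_1_r (Cmod q ^ n)) at 2.
  apply Rmult_le_compat_l; [now apply pow_le|].
  rewrite <- (pow1 (n * (n + 1) / 2 - n)). apply pow_incr. lra.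
- apply ex_series_geom. rewrite Rabs_pos_eq; lra.
Qed.

(* Main.v *)
(** Write [a_n = (q;q^2)_n / (q^2;q^2)_n] and [P_n = 1 / a_n].  Splitting
    [(q;q)_(2n) = (q;q^2)_n (q^2;q^2)_n] and [(q^2;q^2)_n = (q;q)_n (-q;q)_n]
    turns the [n]-th summand into [(-q;q)_oo^2 (q;q)_oo * a_n q^n].  Everything
    then reduces to three limits all equal to [psi q]: the product
    [(-q;q)_oo^2 (q;q)_oo] (Gauss), the limit of [P_n], and the series of
    [a_n q^n] (a case of the q-binomial theorem); the term [n = 0] accounts for
    the subtracted [psi q].

    The three limits come from one array
    [G(n,N) = P_n * sum_(s < N) a_s q^((2n+1)s)].  Its diagonal is a partial sum
    of the theta series (Shanks' finite form of Gauss' identity) and is close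
    to [P_n], as only [s = 0] survives for large [n].  Its row [n = 0] is a
    partial sum of the q-binomial series, and moving from [G(N,N)] to [G(0,N)]
    costs [O(N |q|^N)].

    The coefficients [B'(n)] are read off [psi^2 - psi] by a Cauchy product. *)
Require Import Defs.
From Stdlib Require Import Reals ZArith List Lra Lia.
From Coquelicot Require Import Coquelicot.
Open Scope C_scope.

(** * Limits and series of complex numbers *)

(** Reducing to a real sequence tending to 0 makes squeezing and the real limit laws available. *)
Definition clim (u : nat -> C) (l : C) : Prop :=
  is_lim_seq (fun n => Cmod (u n - l)) 0%R.

Lemma filterlim_clim (u : nat -> C) (l : C) :
  filterlim u eventually (locally l) <-> clim u l.
Proof.
  unfold clim. rewrite <- is_lim_seq_spec. simpl.
  rewrite (filterlim_locally_ball_norm (U := C_NormedModule)).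
  split; intros H eps; destruct (H eps) as [N HN]; exists N; intros n Hn;
    specialize (HN n Hn).
  - unfold ball_norm in HN.
    change (Cmod (u n - l) < eps)%R in HN.
    rewrite Rminus_0_r, Rabs_pos_eq by apply Cmod_ge_0. exact HN.
  - rewrite Rminus_0_r, Rabs_pos_eq in HN by apply Cmod_ge_0. exact HN.
Qed.

(** Transfers a known limit to a nearby sequence: from the diagonal of the array to [P_n] and to row
    0, and later in the Cauchy product. *)
Lemma clim_dist (u v : nat -> C) (l : C) :
  clim v l -> is_lim_seq (fun n => Cmod (u n - v n)) 0%R -> clim u l.
Proof.
  intros Hv Huv. unfold clim.
  apply (is_lim_seq_le_le (fun _ => 0%R) _
           (fun n => Cmod (u n - v n) + Cmod (v n - l))%R).
  - intros n. split; [apply Cmod_ge_0|].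
    replace (u n - l) with ((u n - v n) + (v n - l)) by ring.
    apply Cmod_triangle.
  - apply is_lim_seq_const.
  - replace (Finite 0) with (Finite (0 + 0)) by (f_equal; ring).
    now apply is_lim_seq_plus'.
Qed.

Lemma clim_ext (u v : nat -> C) (l : C) :
  (forall n, u n = v n) -> clim u l -> clim v l.
Proof.
  intros H. apply is_lim_seq_ext. intros n. now rewrite H.
Qed.

Lemma clim_const (l : C) : clim (fun _ => l) l.
Proof.
  apply (is_lim_seq_ext (fun _ => 0%R)).
  - intros _. replace (l - l) with (0 : C) by ring. now rewrite Cmod_0.
  - apply is_lim_seq_const.
Qed.

Lemma clim_unique (u : nat -> C) (l m : C) : clim u l -> clim u m -> l = m.
Proof.
  intros Hl Hm. apply filterlim_clim in Hl, Hm.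
  exact (filterlim_locally_unique (V := C_NormedModule) u l m Hl Hm).
Qed.

Lemma clim_Cmod (u : nat -> C) (l : C) :
  clim u l -> is_lim_seq (fun n => Cmod (u n)) (Cmod l).
Proof.
  intros H. apply filterlim_clim in H.
  exact (filterlim_comp _ _ _ u Cmod _ _ _ H
           (filterlim_norm (V := C_NormedModule) l)).
Qed.

Lemma clim_plus (u v : nat -> C) (l m : C) :
  clim u l -> clim v m -> clim (fun n => u n + v n) (l + m).
Proof.
  intros Hu Hv. unfold clim.
  apply (is_lim_seq_le_le (fun _ => 0%R) _
           (fun n => Cmod (u n - l) + Cmod (v n - m))%R).
  - intros n. split; [apply Cmod_ge_0|].
    replace (u n + v n - (l + m)) with ((u n - l) + (v n - m)) by ring.
    apply Cmod_triangle.
  - apply is_lim_seq_const.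
  - replace (Finite 0) with (Finite (0 + 0)) by (f_equal; ring).
    now apply is_lim_seq_plus'.
Qed.

Lemma clim_mult (u v : nat -> C) (l m : C) :
  clim u l -> clim v m -> clim (fun n => u n * v n) (l * m).
Proof.
  intros Hu Hv. unfold clim.
  apply (is_lim_seq_le_le (fun _ => 0%R) _
           (fun n => Cmod (u n - l) * Cmod (v n) + Cmod l * Cmod (v n - m))%R).
  - intros n. split; [apply Cmod_ge_0|].
    replace (u n * v n - l * m) with ((u n - l) * v n + l * (v n - m)) by ring.
    rewrite <- !Cmod_mult. apply Cmod_triangle.
  - apply is_lim_seq_const.
  - replace (Finite 0) with (Finite (0 * Cmod m + Cmod l * 0)%R)
      by (f_equal; ring).
    apply is_lim_seq_plus'; apply is_lim_seq_mult'; try assumption.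
    + now apply clim_Cmod.
    + apply is_lim_seq_const.
Qed.

Lemma clim_comp (u : nat -> C) (l : C) (phi : nat -> nat) :
  (forall n, (n <= phi n)%nat) -> clim u l -> clim (fun n => u (phi n)) l.
Proof.
  intros Hphi H. refine (is_lim_seq_subseq _ _ phi _ H).
  intros P [N HN]. exists N. intros n Hn. apply HN. specialize (Hphi n). lia.
Qed.

(* Sums over [k < n], whereas [sum_n] includes the index [n]. *)
Fixpoint psum (u : nat -> C) (n : nat) : C :=
  match n with
  | O => 0
  | S m => psum u m + u m
  end.

Lemma psum_sum_n (u : nat -> C) (n : nat) : psum u (S n) = sum_n u n.
Proof.
  induction n as [|n IH].
  - rewrite sum_O. simpl. ring.
  - rewrite sum_Sn, <- IH. reflexivity.
Qed.

Lemma is_series_clim (u : nat -> C) (l : C) : is_series u l <-> clim (psum u) l.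
Proof.
  transitivity (clim (fun n => psum u (S n)) l).
  - rewrite <- filterlim_clim. unfold is_series.
    split; apply filterlim_ext; intros n; now rewrite psum_sum_n.
  - unfold clim.
    symmetry. apply (is_lim_seq_incr_1 (fun n => Cmod (psum u n - l))).
Qed.

Lemma psum_ext (u v : nat -> C) (n : nat) :
  (forall k, (k < n)%nat -> u k = v k) -> psum u n = psum v n.
Proof.
  induction n as [|n IH]; intros H; simpl; [reflexivity|].
  rewrite IH, H; auto.
Qed.

Lemma psum_plus (u v : nat -> C) (n : nat) :
  psum (fun k => u k + v k) n = psum u n + psum v n.
Proof. induction n as [|n IH]; simpl; [|rewrite IH]; ring. Qed.

Lemma psum_scal (c : C) (u : nat -> C) (n : nat) :
  psum (fun k => c * u k) n = c * psum u n.
Proof. induction n as [|n IH]; simpl; [|rewrite IH]; ring. Qed.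

Lemma psum_shift (u : nat -> C) (n : nat) :
  psum u (S n) = u O + psum (fun k => u (S k)) n.
Proof.
  induction n as [|n IH]; [simpl; ring|].
  change (psum u (S (S n))) with (psum u (S n) + u (S n)).
  rewrite IH. simpl. ring.
Qed.

Lemma psum_bound (u : nat -> C) (c : R) (n : nat) :
  (forall k, (k < n)%nat -> (Cmod (u k) <= c)%R) ->
  (Cmod (psum u n) <= INR n * c)%R.
Proof.
  induction n as [|n IH]; intros H.
  - simpl. rewrite Cmod_0. lra.
  - rewrite S_INR. simpl psum. eapply Rle_trans; [apply Cmod_triangle|].
    assert (Cmod (psum u n) <= INR n * c)%R by (apply IH; auto).
    assert (Cmod (u n) <= c)%R by (apply H; lia). lra.
Qed.

Lemma is_series_tail (u : nat -> C) (l : C) :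
  is_series u (l + u O) -> is_series (fun n => u (S n)) l.
Proof. apply (is_series_incr_1 (V := C_NormedModule) u l). Qed.

(* With [s = sqrt r], [n s^n] is at most the geometric sum [1 / (1 - s)]. *)
Lemma is_lim_seq_n_pow (r : R) : (0 <= r < 1)%R ->
  is_lim_seq (fun n => INR n * r ^ n)%R 0%R.
Proof.
  intros Hr. set (s := sqrt r).
  assert (Hs0 : (0 <= s)%R) by apply sqrt_pos.
  assert (Hss : (s * s = r)%R) by (apply sqrt_sqrt; lra).
  assert (Hs1 : (s < 1)%R) by nra.
  assert (Hsn : forall n, (0 <= s ^ n)%R) by (intros n; now apply pow_le).
  assert (Hb : forall n, (INR n * s ^ n * (1 - s) <= 1 - s ^ n)%R).
  { induction n as [|n IH]; [simpl; lra|].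
    rewrite S_INR. simpl pow. specialize (Hsn n).
    assert (0 <= INR n * s ^ n)%R
      by (apply Rmult_le_pos; [apply pos_INR|assumption]).
    set (t := (s ^ n)%R) in *. set (m := INR n) in *.
    assert (0 <= m * t * (1 - s))%R by (apply Rmult_le_pos; lra).
    assert (s * (m * t * (1 - s)) <= s * (1 - t))%R
      by (apply Rmult_le_compat_l; assumption).
    (* This product is exactly the gap between the bound [s - s^2 t] and the target [1 - s t]. *)
    assert (0 <= (1 - s) * (1 - s * t))%R by (apply Rmult_le_pos; nra).
    nra. }
  apply (is_lim_seq_le_le (fun _ => 0%R) _ (fun n => / (1 - s) * s ^ n)%R).
  - intros n. split.
    + apply Rmult_le_pos; [apply pos_INR|]. apply pow_le; lra.
    + rewrite <- Hss, Rpow_mult_distr, <- Rmult_assoc.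
      apply Rmult_le_compat_r; [apply Hsn|].
      apply Rmult_le_reg_r with (1 - s)%R; [lra|].
      rewrite Rinv_l by lra. specialize (Hb n). specialize (Hsn n). lra.
  - apply is_lim_seq_const.
  - replace (Finite 0) with (Rbar_mult (/ (1 - s))%R 0%R)
      by (simpl; f_equal; ring).
    apply is_lim_seq_scal_l, is_lim_seq_geom. rewrite Rabs_pos_eq; lra.
Qed.

(** The common shape of the error estimates below: [n] terms, each [O(r^n)]. *)
Lemma is_lim_seq_n_pow_scal (u : nat -> R) (c r : R) : (0 <= r < 1)%R ->
  (forall n, 0 <= u n <= c * (INR n * r ^ n))%R -> is_lim_seq u 0%R.
Proof.
  intros Hr Hu.
  apply (is_lim_seq_le_le (fun _ => 0%R) _ (fun n => c * (INR n * r ^ n))%R _ Hu).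
  - apply is_lim_seq_const.
  - replace (Finite 0) with (Rbar_mult c 0%R) by (simpl; f_equal; ring).
    now apply is_lim_seq_scal_l, is_lim_seq_n_pow.
Qed.

(** * q-Pochhammer symbols *)

Lemma Cmod_one_minus (z : C) (r : R) :
  (Cmod z <= r)%R -> (1 - r <= Cmod (1 - z))%R.
Proof.
  intros Hz. pose proof (Cmod_triangle (1 - z) z) as H.
  replace (1 - z + z) with (1 : C) in H by ring. rewrite Cmod_1 in H. lra.
Qed.

Lemma Cmod_one_minus_le (z : C) : (Cmod (1 - z) <= 1 + Cmod z)%R.
Proof.
  unfold Cminus. eapply Rle_trans; [apply Cmod_triangle|].
  rewrite Cmod_1, Cmod_opp. lra.
Qed.

Lemma pow_le_1 (r : R) (n : nat) : (0 <= r < 1)%R -> (0 <= r ^ n <= 1)%R.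
Proof.
  intros Hr. split; [apply pow_le; lra|].
  rewrite <- (pow1 n). apply pow_incr. lra.
Qed.

Lemma pow_le_exponent (r : R) (m n : nat) : (0 <= r < 1)%R ->
  (m <= n)%nat -> (r ^ n <= r ^ m)%R.
Proof.
  intros Hr Hmn. replace n with (m + (n - m))%nat by lia. rewrite pow_add.
  pose proof (pow_le_1 r m Hr). pose proof (pow_le_1 r (n - m) Hr). nra.
Qed.

Lemma Cmod_pow_le (q : C) (m n : nat) : (Cmod q < 1)%R ->
  (m <= n)%nat -> (Cmod (q ^ n) <= Cmod q ^ m)%R.
Proof.
  intros Hq H. rewrite Cmod_pow. apply pow_le_exponent; [|exact H].
  split; [apply Cmod_ge_0|exact Hq].
Qed.

Lemma Cmod_one_minus_pow (q : C) (n : nat) : (Cmod q < 1)%R ->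
  (1 - Cmod q <= Cmod (1 - q ^ S n))%R.
Proof.
  intros Hq. apply Cmod_one_minus.
  rewrite <- (pow_1 (Cmod q)). apply Cmod_pow_le; [exact Hq|lia].
Qed.

Lemma one_minus_pow_neq0 (q : C) (n : nat) : (Cmod q < 1)%R ->
  1 - q ^ S n <> 0.
Proof.
  intros Hq H. pose proof (Cmod_one_minus_pow q n Hq) as Hn.
  rewrite H, Cmod_0 in Hn. lra.
Qed.

Lemma exp_nondecreasing (x y : R) : (x <= y)%R -> (exp x <= exp y)%R.
Proof.
  intros [H| ->]; [left; now apply exp_increasing|apply Rle_refl].
Qed.

Lemma qpoch_le (a q : C) (n : nat) : (Cmod q < 1)%R ->
  (Cmod (qpoch a q n) <= exp (Cmod a * / (1 - Cmod q)))%R.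
Proof.
  intros Hq. pose proof (Cmod_ge_0 a). pose proof (Cmod_ge_0 q).
  eapply Rle_trans; [now apply qpoch_bound|].
  assert (0 <= Cmod a * / (1 - Cmod q))%R.
  { apply Rmult_le_pos; [lra|]. left. apply Rinv_0_lt_compat. lra. }
  pose proof (pow_le_1 (Cmod q) n ltac:(lra)).
  apply exp_nondecreasing. nra.
Qed.

(** With [K = |a|/(1-|a|)], each factor has modulus at least [1 - |a||q|^j >= exp(-K|q|^j)], and the
    exponents form a geometric series. The bound is uniform in [n], so it survives in the infinite
    product. *)
Lemma qpoch_ge (a q : C) (n : nat) : (Cmod q < 1)%R -> (Cmod a < 1)%R ->
  (exp (- (Cmod a / (1 - Cmod a) * / (1 - Cmod q))) <= Cmod (qpoch a q n))%R.
Proof.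
  intros Hq Ha. pose proof (Cmod_ge_0 a) as Ha0. pose proof (Cmod_ge_0 q) as Hq0.
  set (K := (Cmod a / (1 - Cmod a))%R).
  assert (HK : (0 <= K)%R).
  { apply Rmult_le_pos; [lra|]. left. apply Rinv_0_lt_compat. lra. }
  assert (HKa : (K * (1 - Cmod a) = Cmod a)%R) by (unfold K; field; lra).
  set (c := (K * / (1 - Cmod q))%R).
  assert (Hc : (0 <= c)%R).
  { apply Rmult_le_pos; [lra|]. left. apply Rinv_0_lt_compat. lra. }
  assert (Hcq : (c * (1 - Cmod q) = K)%R) by (unfold c; field; lra).
  (* The factor [1 - |q|^n] turns the exponent into a partial geometric sum, which makes the
     induction close. *)
  assert (H : (exp (- (c * (1 - Cmod q ^ n))) <= Cmod (qpoch a q n))%R).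
  { induction n as [|n IH].
    - simpl. rewrite Cmod_1. replace (- _)%R with 0%R by ring. rewrite exp_0. lra.
    - change (qpoch a q (S n)) with (qpoch a q n * (1 - a * q ^ n)).
      rewrite Cmod_mult.
      pose proof (pow_le_1 (Cmod q) n ltac:(lra)) as Ht.
      replace (- (c * (1 - Cmod q ^ S n)))%R
        with (- (c * (1 - Cmod q ^ n)) + - (K * Cmod q ^ n))%R
        by (rewrite <- Hcq; simpl; ring).
      rewrite exp_plus.
      apply Rmult_le_compat; try (left; apply exp_pos); [exact IH|].
      apply Rle_trans with (1 - Cmod a * Cmod q ^ n)%R.
      + set (t := (Cmod q ^ n)%R) in *.
        pose proof (exp_ineq1_le (K * t)) as He.
        rewrite exp_Ropp.
        assert (Hp : (0 < exp (K * t))%R) by apply exp_pos.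
        apply Rmult_le_reg_l with (exp (K * t)); [exact Hp|].
        rewrite Rinv_r by lra.
        assert (0 <= K * t)%R by (apply Rmult_le_pos; lra).
        assert (0 <= Cmod a * (1 - t))%R by (apply Rmult_le_pos; lra).
        assert (0 <= 1 - Cmod a * t)%R by lra.
        (* By the choice of [K] this product equals [1 + K |a| t (1 - t)], hence is at least 1. *)
        apply Rle_trans with ((1 + K * t) * (1 - Cmod a * t))%R.
        * replace ((1 + K * t) * (1 - Cmod a * t))%R
            with (1 + K * t * (Cmod a * (1 - t)) + t * (K * (1 - Cmod a) - Cmod a))%R
            by ring.
          rewrite HKa.
          assert (0 <= K * t * (Cmod a * (1 - t)))%R
            by (apply Rmult_le_pos; assumption).
          lra.
        * apply Rmult_le_compat_r; lra.
      + apply Cmod_one_minus. rewrite Cmod_mult, Cmod_pow. lra. }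
  eapply Rle_trans; [|exact H].
  pose proof (pow_le_1 (Cmod q) n ltac:(lra)).
  apply exp_nondecreasing. nra.
Qed.

Lemma qpoch_neq0 (a q : C) (n : nat) : (Cmod q < 1)%R -> (Cmod a < 1)%R ->
  qpoch a q n <> 0.
Proof.
  intros Hq Ha H. pose proof (qpoch_ge a q n Hq Ha) as Hn.
  rewrite H, Cmod_0 in Hn.
  pose proof (exp_pos (- (Cmod a / (1 - Cmod a) * / (1 - Cmod q)))). lra.
Qed.

Lemma qpoch_ratio_bounded (a b q : C) :
  (Cmod q < 1)%R -> (Cmod b < 1)%R ->
  exists M : R, (0 <= M)%R /\
    forall n, (Cmod (qpoch a q n / qpoch b q n) <= M)%R.
Proof.
  intros Hq Hb.
  set (e := exp (- (Cmod b / (1 - Cmod b) * / (1 - Cmod q)))).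
  assert (He : (0 < e)%R) by apply exp_pos.
  exists (exp (Cmod a * / (1 - Cmod q)) * / e)%R. split.
  - apply Rmult_le_pos; left; [apply exp_pos|now apply Rinv_0_lt_compat].
  - intros n. rewrite Cmod_div by now apply qpoch_neq0.
    apply Rmult_le_compat; [apply Cmod_ge_0| | |].
    + left. apply Rinv_0_lt_compat, Cmod_gt_0. now apply qpoch_neq0.
    + now apply qpoch_le.
    + apply Rinv_le_contravar; [exact He|]. now apply qpoch_ge.
Qed.

Lemma qpoch_inf_clim (a q : C) : (Cmod q < 1)%R ->
  clim (qpoch a q) (qpoch_inf a q).
Proof. intros Hq. now apply filterlim_clim, qpoch_inf_correct. Qed.

Lemma qpoch_inf_neq0 (a q : C) : (Cmod q < 1)%R -> (Cmod a < 1)%R ->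
  qpoch_inf a q <> 0.
Proof.
  intros Hq Ha H.
  pose proof (clim_Cmod _ _ (qpoch_inf_clim a q Hq)) as Hl.
  rewrite H, Cmod_0 in Hl.
  pose proof (is_lim_seq_le _ _ _ _ (fun n => qpoch_ge a q n Hq Ha)
                (is_lim_seq_const _) Hl) as Hle.
  simpl in Hle.
  pose proof (exp_pos (- (Cmod a / (1 - Cmod a) * / (1 - Cmod q)))). lra.
Qed.

Lemma qpoch_add (a q : C) (m n : nat) :
  qpoch a q (m + n) = qpoch a q m * qpoch (a * q ^ m) q n.
Proof.
  induction n as [|n IH].
  - rewrite Nat.add_0_r. simpl. ring.
  - rewrite Nat.add_succ_r. simpl. rewrite IH, Cpow_add_r. ring.
Qed.

Lemma qpoch_inf_add (a q : C) (m : nat) : (Cmod q < 1)%R ->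
  qpoch_inf a q = qpoch a q m * qpoch_inf (a * q ^ m) q.
Proof.
  intros Hq. apply (clim_unique (fun n => qpoch a q (m + n))).
  - apply (clim_comp (qpoch a q) _ (fun n => (m + n)%nat)); [intros n; lia|].
    now apply qpoch_inf_clim.
  - apply (clim_ext (fun n => qpoch a q m * qpoch (a * q ^ m) q n)).
    + intros n. now rewrite qpoch_add.
    + apply clim_mult; [apply clim_const|]. now apply qpoch_inf_clim.
Qed.

(** The factors [1 - q^j], [1 <= j <= 2n], are sorted by the parity of [j]. *)
Lemma qpoch_even_odd (q : C) (n : nat) :
  qpoch q q (2 * n) = qpoch q (q ^ 2) n * qpoch (q ^ 2) (q ^ 2) n.
Proof.
  induction n as [|n IH]; [simpl; ring|].
  replace (2 * S n)%nat with (S (S (2 * n))) by lia.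
  cbn [qpoch]. rewrite IH, <- Cpow_mult_r.
  change (q ^ S (2 * n)) with (q * q ^ (2 * n)).
  generalize (q ^ (2 * n)). intros x. ring.
Qed.

(** Factor by factor, [1 - q^(2j) = (1 - q^j)(1 + q^j)]. *)
Lemma qpoch_square (q : C) (n : nat) :
  qpoch (q ^ 2) (q ^ 2) n = qpoch q q n * qpoch (- q) q n.
Proof.
  induction n as [|n IH]; [simpl; ring|].
  cbn [qpoch]. rewrite IH, <- Cpow_mult_r, Nat.mul_comm, Cpow_mult_r.
  simpl (_ ^ 2). ring.
Qed.

(** * The product formula for [psi] and the q-binomial series *)

Definition gauss_prod (q : C) (n : nat) : C :=
  qpoch (q ^ 2) (q ^ 2) n / qpoch q (q ^ 2) n.

(** By the q-binomial theorem in base [q^2], the coefficient of [z^n] in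
    [(qz;q^2)_oo / (z;q^2)_oo]. *)
Definition gauss_coef (q : C) (n : nat) : C :=
  qpoch q (q ^ 2) n / qpoch (q ^ 2) (q ^ 2) n.

Lemma Cmod_sqr_lt_1 (q : C) : (Cmod q < 1)%R -> (Cmod (q ^ 2) < 1)%R.
Proof.
  intros Hq.
  rewrite Cmod_pow. pose proof (Cmod_ge_0 q). simpl. nra.
Qed.

Lemma gauss_prod_S (q : C) (n : nat) : (Cmod q < 1)%R ->
  gauss_prod q (S n) =
    gauss_prod q n * (1 - q ^ (2 * n + 2)) / (1 - q ^ (2 * n + 1)).
Proof.
  intros Hq.
  pose proof (Cmod_sqr_lt_1 q Hq). unfold gauss_prod. cbn [qpoch].
  rewrite <- Cpow_mult_r, !Cpow_add_r, Cpow_1_r.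
  rewrite (Cmult_comm (q ^ (2 * n)) q), (Cmult_comm (q ^ (2 * n)) (q ^ 2)).
  field. split; [now apply qpoch_neq0|].
  apply (one_minus_pow_neq0 q (2 * n) Hq).
Qed.

Lemma gauss_coef_S (q : C) (n : nat) : (Cmod q < 1)%R ->
  gauss_coef q (S n) * (1 - q ^ (2 * n + 2)) =
    gauss_coef q n * (1 - q ^ (2 * n + 1)).
Proof.
  intros Hq.
  pose proof (Cmod_sqr_lt_1 q Hq). unfold gauss_coef. cbn [qpoch].
  rewrite <- Cpow_mult_r, !Cpow_add_r, Cpow_1_r.
  rewrite (Cmult_comm (q ^ (2 * n)) q), (Cmult_comm (q ^ (2 * n)) (q ^ 2)).
  field. split; [now apply qpoch_neq0|].
  pose proof (one_minus_pow_neq0 q (S (2 * n)) Hq) as Hn.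
  replace (q ^ 2 * q ^ (2 * n)) with (q ^ S (S (2 * n))) by (simpl; ring).
  exact Hn.
Qed.

Lemma gauss_prod_coef (q : C) (n : nat) : (Cmod q < 1)%R ->
  gauss_prod q n * gauss_coef q n = 1.
Proof.
  intros Hq.
  pose proof (Cmod_sqr_lt_1 q Hq). unfold gauss_prod, gauss_coef. field.
  split; now apply qpoch_neq0.
Qed.

Definition gauss_partial (q z : C) (N : nat) : C :=
  psum (fun s => gauss_coef q s * z ^ s) N.

(* The recurrence [gauss_coef_S] makes the two sides differ by a telescoping
   sum. *)
Lemma gauss_partial_rec (q z : C) (N : nat) : (Cmod q < 1)%R ->
  (1 - q * z) * gauss_partial q (q ^ 2 * z) N =
    (1 - z) * gauss_partial q z N
      + gauss_coef q N * z ^ N * (1 - q ^ (2 * N)).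
Proof.
  intros Hq.
  induction N as [|N IH]; unfold gauss_partial in *.
  - simpl. ring.
  - cbn [psum]. rewrite !Cmult_plus_distr_l, IH.
    replace (2 * S N)%nat with (2 * N + 2)%nat by lia.
    (* Isolates [gauss_coef q (S N)] together with its factor, ready for the recurrence. *)
    transitivity ((1 - z) * psum (fun s => gauss_coef q s * z ^ s) N +
      (1 - z) * (gauss_coef q N * z ^ N) +
      gauss_coef q (S N) * (1 - q ^ (2 * N + 2)) * z ^ S N); [|ring].
    rewrite gauss_coef_S by exact Hq.
    rewrite Cpow_mult_l, <- Cpow_mult_r, Cpow_add_r, Cpow_1_r.
    simpl (z ^ S N). ring.
Qed.

(** The array [G(n,N)]: with [z = q^(2n+1)], the substitution of [q^2 z] for [z] is a step from row
    [n] to row [n+1]. *)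
Definition gauss_array (q : C) (n N : nat) : C :=
  gauss_prod q n * gauss_partial q (q ^ (2 * n + 1)) N.

(** At [z = q^(2n+1)] the factors [1 - qz] and [1 - z] of [gauss_partial_rec] form the ratio
    [P_(n+1)/P_n], so they cancel and only the boundary term remains. *)
Lemma gauss_array_S (q : C) (n N : nat) : (Cmod q < 1)%R ->
  gauss_array q (S n) N = gauss_array q n N +
    gauss_prod q n * gauss_coef q N * q ^ ((2 * n + 1) * N)
      * (1 - q ^ (2 * N)) / (1 - q ^ (2 * n + 1)).
Proof.
  intros Hq.
  unfold gauss_array. rewrite gauss_prod_S by exact Hq.
  pose proof (gauss_partial_rec q (q ^ (2 * n + 1)) N Hq) as H.
  rewrite <- Cpow_mult_r in H.
  replace (q * q ^ (2 * n + 1)) with (q ^ (2 * n + 2)) in H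
    by (rewrite !Cpow_add_r; simpl; ring).
  replace (q ^ 2 * q ^ (2 * n + 1)) with (q ^ (2 * S n + 1)) in H
    by (rewrite <- Cpow_add_r; f_equal; lia).
  assert (Hz : 1 - q ^ (2 * n + 1) <> 0).
  { rewrite Nat.add_1_r. now apply one_minus_pow_neq0. }
  set (x := gauss_partial q (q ^ (2 * S n + 1)) N) in *.
  transitivity (gauss_prod q n * ((1 - q ^ (2 * n + 2)) * x) / (1 - q ^ (2 * n + 1))).
  - field. exact Hz.
  - rewrite H. field. exact Hz.
Qed.

(* Going from [n] to [n + 1] adds [q^(n(2n+1)) (1 + q^(2n+1))], the triangular
   terms of indices [2n] and [2n + 1]. *)
Lemma gauss_array_diag (q : C) (n : nat) : (Cmod q < 1)%R ->
  gauss_array q n n = psum (triangular_term q) (2 * n).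
Proof.
  intros Hq.
  induction n as [|n IH].
  - unfold gauss_array, gauss_partial. simpl. ring.
  - assert (Hz : 1 - q ^ (2 * n + 1) <> 0).
    { rewrite Nat.add_1_r. now apply one_minus_pow_neq0. }
    replace (2 * S n)%nat with (S (S (2 * n))) by lia. cbn [psum].
    rewrite <- IH. unfold triangular_term.
    replace (2 * n * (2 * n + 1) / 2)%nat with ((2 * n + 1) * n)%nat.
    2: { replace (2 * n * (2 * n + 1))%nat with ((2 * n + 1) * n * 2)%nat by lia.
         now rewrite Nat.div_mul. }
    replace (S (2 * n) * (S (2 * n) + 1) / 2)%nat
      with ((2 * n + 1) * n + (2 * n + 1))%nat.
    2: { replace (S (2 * n) * (S (2 * n) + 1))%nat
           with (((2 * n + 1) * n + (2 * n + 1)) * 2)%nat by lia.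
         now rewrite Nat.div_mul. }
    (* The diagonal step is split: the last summand [s = n] is taken off, and the rest is a row
       step. *)
    transitivity (gauss_array q (S n) n +
      gauss_prod q (S n) * (gauss_coef q n * q ^ ((2 * S n + 1) * n))).
    { unfold gauss_array, gauss_partial. cbn [psum]. rewrite <- Cpow_mult_r. ring. }
    rewrite gauss_array_S, gauss_prod_S by exact Hq.
    replace ((2 * S n + 1) * n)%nat with ((2 * n + 1) * n + 2 * n)%nat by lia.
    rewrite (Cpow_add_r q ((2 * n + 1) * n) (2 * n)),
      (Cpow_add_r q ((2 * n + 1) * n) (2 * n + 1)).
    set (y := q ^ ((2 * n + 1) * n)).
    pose proof (gauss_prod_coef q n Hq) as Hpc.
    (* Both contributions contain [P_n a_n = 1]. The numerator collapses to [1 - q^(4n+2)], so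
       division by [1 - q^(2n+1)] leaves [1 + q^(2n+1)]. *)
    transitivity (gauss_array q n n + (gauss_prod q n * gauss_coef q n) * y *
      (1 - q ^ (2 * n) + q ^ (2 * n) * (1 - q ^ (2 * n + 2)))
        / (1 - q ^ (2 * n + 1))); [field; exact Hz|].
    rewrite Hpc.
    replace (q ^ (2 * n) * (1 - q ^ (2 * n + 2)))
      with (q ^ (2 * n) - q ^ (2 * n + 1) * q ^ (2 * n + 1))
      by (rewrite !Cpow_add_r; simpl; ring).
    field. exact Hz.
Qed.

Lemma gauss_prod_bounded (q : C) : (Cmod q < 1)%R ->
  exists M, (0 <= M)%R /\ forall n, (Cmod (gauss_prod q n) <= M)%R.
Proof.
  intros Hq. pose proof (Cmod_sqr_lt_1 q Hq).
  now apply qpoch_ratio_bounded.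
Qed.

Lemma gauss_coef_bounded (q : C) : (Cmod q < 1)%R ->
  exists M, (0 <= M)%R /\ forall n, (Cmod (gauss_coef q n) <= M)%R.
Proof.
  intros Hq. pose proof (Cmod_sqr_lt_1 q Hq).
  now apply qpoch_ratio_bounded.
Qed.

Lemma gauss_prod_clim (q : C) : (Cmod q < 1)%R ->
  clim (gauss_prod q) (psi q).
Proof.
  intros Hq. pose proof (Cmod_ge_0 q) as Hq0.
  destruct (gauss_prod_bounded q Hq) as [M1 [HM1 HP]].
  destruct (gauss_coef_bounded q Hq) as [M2 [HM2 Ha]].
  apply (clim_dist _ (fun n => gauss_array q n n)).
  - apply (clim_ext (fun n => psum (triangular_term q) (2 * n))).
    { intros n. symmetry. now apply gauss_array_diag. }
    apply (clim_comp _ _ (fun n => (2 * n)%nat)); [intros n; lia|].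
    now apply is_series_clim, psi_correct.
  (* In row [n+1] the term [s = 0] is exactly [P_(n+1)]. The error consists of the other [n] terms,
     with exponents [(2n+3)(k+1) >= n]. *)
  - apply is_lim_seq_incr_1.
    apply (is_lim_seq_n_pow_scal _ (M1 * M2) (Cmod q)); [lra|].
    intros n. split; [apply Cmod_ge_0|].
    unfold gauss_array, gauss_partial. rewrite psum_shift.
    replace (gauss_coef q 0 * (q ^ (2 * S n + 1)) ^ 0) with (1 : C).
    2: { unfold gauss_coef. simpl. field. }
    set (v := psum _ n).
    replace (gauss_prod q (S n) - gauss_prod q (S n) * (1 + v))
      with (- (gauss_prod q (S n) * v)) by ring.
    rewrite Cmod_opp, Cmod_mult, Rmult_assoc.
    apply Rmult_le_compat; try apply Cmod_ge_0; [apply HP|].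
    rewrite <- Rmult_assoc, (Rmult_comm M2), Rmult_assoc.
    apply psum_bound. intros k _.
    rewrite Cmod_mult, <- Cpow_mult_r.
    apply Rmult_le_compat; try apply Cmod_ge_0; [apply Ha|].
    apply Cmod_pow_le; [exact Hq|nia].
Qed.

Lemma gauss_coef_series (q : C) : (Cmod q < 1)%R ->
  is_series (fun n => gauss_coef q n * q ^ n) (psi q).
Proof.
  intros Hq. pose proof (Cmod_ge_0 q) as Hq0.
  destruct (gauss_prod_bounded q Hq) as [M1 [HM1 HP]].
  destruct (gauss_coef_bounded q Hq) as [M2 [HM2 Ha]].
  apply is_series_clim.
  apply (clim_ext (fun N => gauss_array q 0 N)).
  { intros N. unfold gauss_array, gauss_partial, gauss_prod.
    cbn [qpoch Nat.mul Nat.add]. rewrite Cpow_1_r. field. }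
  apply (clim_dist _ (fun n => gauss_array q n n)).
  - apply (clim_ext (fun n => psum (triangular_term q) (2 * n))).
    { intros n. symmetry. now apply gauss_array_diag. }
    apply (clim_comp _ _ (fun n => (2 * n)%nat)); [intros n; lia|].
    now apply is_series_clim, psi_correct.
  (* One row step costs at most [c |q|^N]: the factor 2 bounds [|1 - q^(2N)|], and [1/(1-|q|)]
     bounds the inverse of [1 - q^(2n+1)]. *)
  - set (c := (M1 * M2 * 2 * / (1 - Cmod q))%R).
    apply (is_lim_seq_n_pow_scal _ c (Cmod q)); [lra|].
    intros N. split; [apply Cmod_ge_0|].
    (* The induction climbs from row 0 to row [n] with the column [N] fixed; [n = N] is chosen at
       the end. *)
    assert (H : forall n, (Cmod (gauss_array q 0 N - gauss_array q n N)
                  <= INR n * (c * Cmod q ^ N))%R).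
    { induction n as [|n IH].
      - simpl INR. replace (_ - _) with (0 : C) by ring. rewrite Cmod_0. lra.
      - rewrite S_INR, gauss_array_S by exact Hq.
        set (d := gauss_prod q n * _ * _ * _ / _).
        assert (Hd : (Cmod d <= c * Cmod q ^ N)%R).
        { pose proof (one_minus_pow_neq0 q (2 * n) Hq) as Hz.
          pose proof (Cmod_one_minus_pow q (2 * n) Hq) as Hz'.
          pose proof (Cmod_one_minus_le (q ^ (2 * N))) as Hy.
          pose proof (Cmod_pow_le q 0 (2 * N) Hq ltac:(lia)) as Hy'.
          simpl pow in Hy'.
          unfold d. rewrite Nat.add_1_r, Cmod_div by exact Hz.
          rewrite !Cmod_mult.
          replace (c * Cmod q ^ N)%R
            with (M1 * M2 * Cmod q ^ N * 2 * / (1 - Cmod q))%R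
            by (unfold c; ring).
          repeat apply Rmult_le_compat;
            repeat apply Rmult_le_pos; try apply Cmod_ge_0.
          + left. apply Rinv_0_lt_compat. lra.
          + apply HP.
          + apply Ha.
          + apply Cmod_pow_le; [exact Hq|nia].
          + lra.
          + apply Rinv_le_contravar; lra. }
        replace (gauss_array q 0 N - (gauss_array q n N + d))
          with ((gauss_array q 0 N - gauss_array q n N) + - d) by ring.
        eapply Rle_trans; [apply Cmod_triangle|]. rewrite Cmod_opp. lra. }
    specialize (H N). lra.
Qed.

(** [P_n (q;q)_(2n) = (q^2;q^2)_n^2 = ((q;q)_n (-q;q)_n)^2]. In the limit this gives
    [psi E = (E A)^2], and [E] is nonzero. *)
Lemma psi_product (q : C) : (Cmod q < 1)%R ->
  psi q = qpoch_inf (- q) q ^ 2 * qpoch_inf q q.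
Proof.
  intros Hq. pose proof (Cmod_sqr_lt_1 q Hq) as Hq2.
  set (A := qpoch_inf (- q) q). set (E := qpoch_inf q q).
  assert (HE : E <> 0) by now apply qpoch_inf_neq0.
  assert (HcA : clim (qpoch (- q) q) A) by now apply qpoch_inf_clim.
  assert (HcE : clim (qpoch q q) E) by now apply qpoch_inf_clim.
  assert (H : psi q * E = (E * A) * (E * A)).
  { apply (clim_unique (fun n => gauss_prod q n * qpoch q q (2 * n))).
    - apply clim_mult; [now apply gauss_prod_clim|].
      apply (clim_comp _ _ (fun n => (2 * n)%nat)); [intros n; lia|exact HcE].
    - apply (clim_ext (fun n => (qpoch q q n * qpoch (- q) q n)
                                * (qpoch q q n * qpoch (- q) q n))).
      + intros n. rewrite qpoch_even_odd, <- qpoch_square. unfold gauss_prod.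
        field. now apply qpoch_neq0.
      + apply clim_mult; now apply clim_mult. }
  transitivity (psi q * E / E); [field; exact HE|].
  rewrite H. field. exact HE.
Qed.

Lemma summand_gauss_coef (q : C) (n : nat) : (Cmod q < 1)%R ->
  summand q n = psi q * (gauss_coef q n * q ^ n).
Proof.
  intros Hq. pose proof (Cmod_sqr_lt_1 q Hq) as Hq2.
  assert (Hmq : (Cmod (- q) < 1)%R) by now rewrite Cmod_opp.
  rewrite psi_product by exact Hq. unfold summand, gauss_coef.
  rewrite (qpoch_inf_add (- q) q n Hq), (qpoch_inf_add q q n Hq).
  rewrite Nat.add_1_r. change (q ^ S n) with (q * q ^ n).
  replace (- (q * q ^ n)) with (- q * q ^ n) by ring.
  pose proof (qpoch_even_odd q n) as H1.
  replace (2 * n)%nat with (n + n)%nat in H1 by lia.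
  rewrite qpoch_add, qpoch_square in H1. rewrite qpoch_square.
  assert (HE : qpoch q q n <> 0) by now apply qpoch_neq0.
  assert (HA : qpoch (- q) q n <> 0) by now apply qpoch_neq0.
  set (R := qpoch (q * q ^ n) q n) in *.
  set (e := qpoch q q n) in *. set (a := qpoch (- q) q n) in *.
  set (o := qpoch q (q ^ 2) n) in *.
  (* Comparing two factorizations of [(q;q)_(2n)] and cancelling [(q;q)_n] gives
     [(q^(n+1);q)_n = (q;q^2)_n (-q;q)_n]. *)
  assert (HR : R = o * a).
  { transitivity (e * R / e); [field; exact HE|]. rewrite H1. field. exact HE. }
  rewrite HR. field. now split.
Qed.

Lemma summand_series (q : C) : (Cmod q < 1)%R ->
  is_series (fun n => summand q (S n)) (psi q ^ 2 - psi q).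
Proof.
  intros Hq. apply is_series_tail.
  (* The summand of index 0 is [psi q], so restoring it completes the sum to [psi^2]. *)
  replace (psi q ^ 2 - psi q + summand q 0) with (psi q * psi q).
  2: { rewrite summand_gauss_coef by exact Hq. unfold gauss_coef. simpl.
       field. }
  apply is_series_clim.
  apply (clim_ext (fun n => psi q * psum (fun k => gauss_coef q k * q ^ k) n)).
  { intros n. rewrite <- psum_scal. apply psum_ext. intros k _.
    symmetry. now apply summand_gauss_coef. }
  apply clim_mult; [apply clim_const|].
  now apply is_series_clim, gauss_coef_series.
Qed.

(** * Integer coefficients *)

Lemma psum_add (u : nat -> C) (m n : nat) :
  psum u (m + n) = psum u m + psum (fun k => u (m + k)%nat) n.
Proof.
  induction n as [|n IH].
  - rewrite Nat.add_0_r. simpl. ring.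
  - rewrite Nat.add_succ_r. simpl. rewrite IH. ring.
Qed.

Lemma psum_minus (u v : nat -> C) (n : nat) :
  psum (fun k => u k - v k) n = psum u n - psum v n.
Proof. induction n as [|n IH]; simpl; [|rewrite IH]; ring. Qed.

Lemma psum_geom_bound (u : nat -> C) (c r : R) (n : nat) : (0 <= r < 1)%R ->
  (forall k, Cmod (u k) <= c * r ^ k)%R ->
  (Cmod (psum u n) <= c * / (1 - r))%R.
Proof.
  intros Hr Hu.
  assert (Hc : (0 <= c)%R).
  { specialize (Hu O). pose proof (Cmod_ge_0 (u O)). simpl in Hu. lra. }
  apply Rle_trans with (c * / (1 - r) * (1 - r ^ n))%R.
  - induction n as [|n IH].
    + simpl. rewrite Cmod_0. lra.
    + simpl psum. eapply Rle_trans; [apply Cmod_triangle|].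
      replace (c * / (1 - r) * (1 - r ^ S n))%R
        with (c * / (1 - r) * (1 - r ^ n) + c * r ^ n)%R by (simpl; field; lra).
      specialize (Hu n). lra.
  - rewrite <- (Rmult_1_r (c * / (1 - r))) at 2.
    apply Rmult_le_compat_l.
    + apply Rmult_le_pos; [exact Hc|]. left. apply Rinv_0_lt_compat. lra.
    + pose proof (pow_le_1 r n Hr). lra.
Qed.

(** The finite blocks starting at [m] obey a geometric bound, which passes to the limit. *)
Lemma series_tail_bound (u : nat -> C) (l : C) (r : R) (m : nat) :
  (0 <= r < 1)%R -> (forall k, Cmod (u k) <= r ^ k)%R -> is_series u l ->
  (Cmod (psum u m - l) <= r ^ m * / (1 - r))%R.
Proof.
  intros Hr Hu Hl. apply is_series_clim in Hl.
  assert (H : clim (fun n => - psum (fun k => u (m + k)%nat) n) (psum u m - l)).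
  { apply (clim_ext (fun n => psum u m + (-1) * psum u (m + n))).
    - intros n. rewrite psum_add. ring.
    - replace (psum u m - l) with (psum u m + (-1) * l) by ring.
      apply clim_plus; [apply clim_const|].
      apply clim_mult; [apply clim_const|].
      apply (clim_comp _ _ (fun n => (m + n)%nat)); [intros n; lia|exact Hl]. }
  refine (is_lim_seq_le _ _ _ _ _ (clim_Cmod _ _ H) (is_lim_seq_const _)).
  intros n. rewrite Cmod_opp. apply psum_geom_bound; [exact Hr|].
  intros k. rewrite <- pow_add. apply Hu.
Qed.

Definition convolution (u v : nat -> C) (n : nat) : C :=
  psum (fun i => u i * v (n - i)%nat) (S n).

(** Both sides sum [u i * v j] over the triangle [i + j < n], by antidiagonals and by rows. *)
Lemma psum_convolution (u v : nat -> C) (n : nat) :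
  psum (convolution u v) n = psum (fun i => u i * psum v (n - i)) n.
Proof.
  induction n as [|n IH]; [reflexivity|].
  change (psum (convolution u v) (S n))
    with (psum (convolution u v) n + convolution u v n).
  rewrite IH.
  transitivity (psum (fun i => u i * psum v (n - i)) (S n) + convolution u v n).
  { cbn [psum]. rewrite Nat.sub_diag. cbn [psum]. ring. }
  unfold convolution. rewrite <- psum_plus. apply psum_ext. intros k Hk.
  replace (S n - k)%nat with (S (n - k)) by lia. simpl. ring.
Qed.

(** The difference from [psum u n * V] is a sum of [n] products of [u k] with a tail of [v], each at
    most [r^k r^(n-k) / (1-r) = r^n / (1-r)]. *)
Lemma is_series_convolution (u v : nat -> C) (U V : C) (r : R) :
  (0 <= r < 1)%R ->
  (forall k, Cmod (u k) <= r ^ k)%R -> (forall k, Cmod (v k) <= r ^ k)%R ->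
  is_series u U -> is_series v V -> is_series (convolution u v) (U * V).
Proof.
  intros Hr Hu Hv HU HV. apply is_series_clim.
  apply (clim_dist _ (fun n => psum u n * V)).
  - apply clim_mult; [now apply is_series_clim|apply clim_const].
  - apply (is_lim_seq_n_pow_scal _ (/ (1 - r)) r Hr).
    intros n. split; [apply Cmod_ge_0|].
    rewrite psum_convolution, (Cmult_comm _ V), <- psum_scal, <- psum_minus.
    rewrite <- Rmult_assoc, (Rmult_comm _ (INR n)), Rmult_assoc.
    apply psum_bound. intros k Hk.
    replace (u k * psum v (n - k) - V * u k)
      with (u k * (psum v (n - k) - V)) by ring.
    rewrite Cmod_mult.
    apply Rle_trans with (r ^ k * (r ^ (n - k) * / (1 - r)))%R.
    + apply Rmult_le_compat; try apply Cmod_ge_0; [apply Hu|].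
      now apply series_tail_bound.
    + rewrite <- Rmult_assoc, <- pow_add.
      replace (k + (n - k))%nat with n by lia. lra.
Qed.

(** * Triangular numbers and the integer coefficients of the theta series *)

Fixpoint zsum (f : nat -> Z) (n : nat) : Z :=
  match n with
  | O => 0
  | S m => (zsum f m + f m)%Z
  end.

Lemma zsum_psum (f : nat -> Z) (n : nat) :
  RtoC (IZR (zsum f n)) = psum (fun k => RtoC (IZR (f k))) n.
Proof.
  induction n as [|n IH]; [reflexivity|].
  simpl. now rewrite plus_IZR, RtoC_plus, IH.
Qed.

Definition triangular (k : nat) : nat := (k * (k + 1) / 2)%nat.

Lemma triangular_S (k : nat) : triangular (S k) = (triangular k + S k)%nat.
Proof.
  unfold triangular.
  replace (S k * (S k + 1))%nat with (k * (k + 1) + S k * 2)%nat by lia.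
  now rewrite Nat.div_add.
Qed.

Lemma triangular_ge (k : nat) : (k <= triangular k)%nat.
Proof. induction k as [|k IH]; [lia|]. rewrite triangular_S. lia. Qed.

Lemma triangular_le (j k : nat) : (j <= k)%nat -> (triangular j <= triangular k)%nat.
Proof.
  induction 1 as [|k _ IH]; [lia|]. rewrite triangular_S. lia.
Qed.

(** The coefficient of [q^n] in [psi]. Searching [k <= n] suffices because [k <= triangular k]. *)
Definition triangular_indicator (n : nat) : Z :=
  if existsb (fun k => Nat.eqb (triangular k) n) (seq 0 (S n)) then 1%Z else 0%Z.

Lemma triangular_indicator_1 (k : nat) : triangular_indicator (triangular k) = 1%Z.
Proof.
  unfold triangular_indicator.
  rewrite (proj2 (existsb_exists _ _)); [reflexivity|].
  exists k. split; [|apply Nat.eqb_refl].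
  apply in_seq. pose proof (triangular_ge k). lia.
Qed.

(** The argument lies strictly between consecutive triangular numbers, which differ by [k+1]. *)
Lemma triangular_indicator_0 (k j : nat) : (j < k)%nat ->
  triangular_indicator (triangular k + S j) = 0%Z.
Proof.
  intros Hj. unfold triangular_indicator.
  destruct (existsb _ _) eqn:He; [|reflexivity].
  apply existsb_exists in He. destruct He as [m [_ Hm]].
  apply Nat.eqb_eq in Hm. exfalso.
  destruct (Nat.le_gt_cases m k) as [H|H].
  - apply triangular_le in H. lia.
  - apply triangular_le in H. rewrite triangular_S in H. lia.
Qed.

Lemma psum_triangular_indicator (q : C) (k : nat) :
  psum (fun n => RtoC (IZR (triangular_indicator n)) * q ^ n) (triangular k)
    = psum (triangular_term q) k.
Proof.
  induction k as [|k IH]; [reflexivity|].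
  rewrite triangular_S, psum_add, IH, psum_shift, Nat.add_0_r, triangular_indicator_1.
  (* Zero is written [0 * 0] so that [psum_scal] can evaluate the sum. *)
  rewrite (psum_ext (fun j => RtoC (IZR (triangular_indicator (triangular k + S j)))
                              * q ^ (triangular k + S j)) (fun _ => 0 * 0) k).
  - rewrite psum_scal.
    change (psum (triangular_term q) (S k))
      with (psum (triangular_term q) k + q ^ triangular k).
    ring.
  - intros j Hj. rewrite triangular_indicator_0 by exact Hj. ring.
Qed.

Lemma triangular_indicator_term_bound (q : C) (n : nat) :
  (Cmod (RtoC (IZR (triangular_indicator n)) * q ^ n) <= Cmod q ^ n)%R.
Proof.
  rewrite Cmod_mult, Cmod_R, Cmod_pow.
  rewrite <- (Rmult_1_l (Cmod q ^ n)) at 2.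
  apply Rmult_le_compat_r; [apply pow_le, Cmod_ge_0|].
  unfold triangular_indicator. destruct (existsb _ _); rewrite Rabs_pos_eq; lra.
Qed.

(** Geometric domination gives some sum; its value is found along the subsequence of triangular
    indices, where the partial sums are those of [psi]. *)
Lemma triangular_indicator_series (q : C) : (Cmod q < 1)%R ->
  is_series (fun n => RtoC (IZR (triangular_indicator n)) * q ^ n) (psi q).
Proof.
  intros Hq. pose proof (Cmod_ge_0 q) as Hq0.
  set (u := fun n => RtoC (IZR (triangular_indicator n)) * q ^ n).
  assert (Hex : ex_series (V := C_NormedModule) u).
  { apply (ex_series_le (V := C_CompleteNormedModule) u (fun n => Cmod q ^ n)%R).
    - intros n. apply triangular_indicator_term_bound.
    - apply ex_series_geom. rewrite Rabs_pos_eq; lra. }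
  destruct Hex as [l Hl].
  replace (psi q) with l; [exact Hl|].
  apply is_series_clim in Hl.
  apply (clim_unique (psum (triangular_term q))).
  - apply (clim_ext (fun k => psum u (triangular k))).
    { intros k. apply psum_triangular_indicator. }
    now apply clim_comp; [apply triangular_ge|].
  - now apply is_series_clim, psi_correct.
Qed.

(** The coefficient of [q^n] in [psi^2 - psi]: ordered representations of [n] as a sum of two
    triangular numbers, minus the indicator. *)
Definition lhs_coef (n : nat) : Z :=
  (zsum (fun i => triangular_indicator i * triangular_indicator (n - i)%nat) (S n)
    - triangular_indicator n)%Z.

Lemma lhs_coef_term (q : C) (n : nat) :
  RtoC (IZR (lhs_coef n)) * q ^ n =
    convolution (fun k => RtoC (IZR (triangular_indicator k)) * q ^ k)
      (fun k => RtoC (IZR (triangular_indicator k)) * q ^ k) n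
    - RtoC (IZR (triangular_indicator n)) * q ^ n.
Proof.
  unfold lhs_coef, convolution.
  rewrite minus_IZR, RtoC_minus, zsum_psum.
  transitivity (q ^ n * psum (fun k => RtoC (IZR
    (triangular_indicator k * triangular_indicator (n - k)))) (S n)
    - RtoC (IZR (triangular_indicator n)) * q ^ n); [ring|].
  f_equal. rewrite <- psum_scal. apply psum_ext. intros k Hk.
  replace n with (k + (n - k))%nat at 1 by lia.
  rewrite Cpow_add_r, mult_IZR, RtoC_mult. ring.
Qed.

Lemma lhs_coef_series (q : C) : (Cmod q < 1)%R ->
  is_series (fun n => RtoC (IZR (lhs_coef (S n))) * q ^ S n) (psi q ^ 2 - psi q).
Proof.
  intros Hq. pose proof (Cmod_ge_0 q) as Hq0.
  apply (is_series_tail (fun n => RtoC (IZR (lhs_coef n)) * q ^ n)).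
  (* At index 0 the coefficient is [1 * 1 - 1 = 0], so the series may start there. *)
  replace (RtoC (IZR (lhs_coef 0)) * q ^ 0) with (0 : C).
  2: { change (lhs_coef 0) with 0%Z. ring. }
  replace (psi q ^ 2 - psi q + 0) with (psi q * psi q + (-1) * psi q)
    by (simpl; ring).
  pose proof (triangular_indicator_series q Hq) as Ht.
  apply is_series_clim.
  set (u := fun k => RtoC (IZR (triangular_indicator k)) * q ^ k) in *.
  apply (clim_ext (fun n => psum (convolution u u) n + (-1) * psum u n)).
  { intros n. rewrite <- psum_scal, <- psum_plus. apply psum_ext. intros k _.
    rewrite lhs_coef_term. unfold u. ring. }
  apply clim_plus.
  - apply is_series_clim, (is_series_convolution u u _ _ (Cmod q)); try assumption;
      [lra| |]; apply triangular_indicator_term_bound.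
  - apply clim_mult; [apply clim_const|]. now apply is_series_clim.
Qed.

(** * Uniqueness of the coefficients, from real arguments *)

Lemma is_series_RtoC (w : nat -> R) (l : C) :
  is_series (fun n => RtoC (w n)) l -> is_series w (Re l).
Proof.
  intros H. apply is_series_clim in H.
  assert (Hp : forall n, Re (psum (fun k => RtoC (w k)) (S n)) = sum_n w n).
  { induction n as [|n IH].
    - rewrite sum_O. simpl. ring.
    - rewrite sum_Sn, <- IH. reflexivity. }
  apply (clim_comp _ _ S) in H; [|intros n; lia].
  change (is_lim_seq (sum_n w) (Re l)).
  apply is_lim_seq_spec. apply is_lim_seq_spec in H.
  intros eps. destruct (H eps) as [N HN]. exists N. intros n Hn.
  specialize (HN n Hn). cbv beta in HN.
  rewrite Rminus_0_r, Rabs_pos_eq in HN by apply Cmod_ge_0.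
  rewrite <- Hp. eapply Rle_lt_trans; [|exact HN].
  exact (re_le_Cmod (psum (fun k => RtoC (w k)) (S n) - l)).
Qed.

Lemma power_series_coef_unique (a b : nat -> R) (f : R -> R) (n : nat) :
  (forall x, (Rabs x < 1)%R -> is_series (fun k => a k * x ^ k)%R (f x)) ->
  (forall x, (Rabs x < 1)%R -> is_series (fun k => b k * x ^ k)%R (f x)) ->
  a n = b n.
Proof.
  intros Ha Hb.
  assert (Hr : forall c, (forall x, (Rabs x < 1)%R ->
      is_series (fun k => c k * x ^ k)%R (f x)) -> Rbar_lt 0 (CV_radius c)).
  { intros c Hc. apply Rbar_not_le_lt. intros H.
    assert (Hh : (Rabs (/ 2) < 1)%R) by (rewrite Rabs_pos_eq; lra).
    apply (CV_disk_outside c (/ 2)).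
    - eapply Rbar_le_lt_trans; [exact H|]. simpl. rewrite Rabs_pos_eq; lra.
    - apply ex_series_lim_0. exists (f (/ 2)%R). now apply Hc. }
  apply PSeries_ext_recip; [now apply Hr|now apply Hr|].
  exists (mkposreal 1 Rlt_0_1). intros x Hx.
  assert (Hx' : (Rabs x < 1)%R).
  { change (Rabs (x - 0) < 1)%R in Hx. now rewrite Rminus_0_r in Hx. }
  unfold PSeries.
  now rewrite (is_series_unique _ _ (Ha x Hx')), (is_series_unique _ _ (Hb x Hx')).
Qed.

Lemma generates_lhs_real (B : nat -> Z) (x : R) :
  generates_lhs B -> (Rabs x < 1)%R ->
  is_series (fun n => IZR (B (S n)) * x ^ n * x)%R (Re (lhs (RtoC x))).
Proof.
  intros HB Hx. apply is_series_RtoC.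
  assert (Hc : (Cmod (RtoC x) < 1)%R) by now rewrite Cmod_R.
  specialize (HB (RtoC x) Hc). apply is_series_clim in HB.
  apply is_series_clim. revert HB. apply clim_ext. intros n.
  apply psum_ext. intros k _.
  rewrite <- RtoC_pow, <- RtoC_mult. f_equal. simpl. ring.
Qed.

Lemma generates_lhs_unique (B1 B2 : nat -> Z) (n : nat) :
  generates_lhs B1 -> generates_lhs B2 -> (1 <= n)%nat -> B1 n = B2 n.
Proof.
  intros H1 H2 Hn.
  (* Index 0 is set to 0, since [generates_lhs] does not constrain that coefficient. *)
  set (c := fun (B : nat -> Z) k => match k with O => 0%R | S _ => IZR (B k) end).
  assert (Hs : forall B, generates_lhs B -> forall x, (Rabs x < 1)%R ->
    is_series (fun k => c B k * x ^ k)%R (Re (lhs (RtoC x)))).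
  { intros B HB x Hx. apply is_series_decr_1.
    apply (is_series_ext (fun k => IZR (B (S k)) * x ^ k * x)%R).
    { intros k. simpl. ring. }
    replace (plus _ _) with (Re (lhs (RtoC x))); [now apply generates_lhs_real|].
    change (Re (lhs (RtoC x)) = Re (lhs (RtoC x)) + - (0 * 1))%R. ring. }
  assert (H : c B1 n = c B2 n)
    by exact (power_series_coef_unique _ _ _ n (Hs B1 H1) (Hs B2 H2)).
  destruct n as [|n]; [lia|]. now apply eq_IZR.
Qed.

Theorem theorem1p4 :
  (exists B' : nat -> Z,
     generates_lhs B' /\
     (forall B'' : nat -> Z, generates_lhs B'' ->
        forall n : nat, (1 <= n)%nat -> B'' n = B' n)) /\
  (forall q : C, (Cmod q < 1)%R ->
     ex_series (fun n : nat => summand q (S n)) /\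
     lhs q = psi q ^ 2 - psi q).
Proof.
  (* The closed form comes first: it is what identifies [lhs] with the sum of the series of
     [lhs_coef]. *)
  assert (Hlhs : forall q, (Cmod q < 1)%R -> lhs q = psi q ^ 2 - psi q).
  { intros q Hq. now apply CSeries_unique, summand_series. }
  split.
  - assert (HB : generates_lhs lhs_coef).
    { intros q Hq. rewrite Hlhs by exact Hq. now apply lhs_coef_series. }
    exists lhs_coef. split; [exact HB|].
    intros B HB' n Hn. now apply generates_lhs_unique.
  - intros q Hq. split; [|now apply Hlhs].
    eexists. now apply summand_series.
Qed.
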